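(* For every integer $k\ge 3$, there is a bipartite $k$-hypertournament $B$ without transmitters which has at most one 4-king in each of its two partite sets.
   Context: Let $n>k\ge 2$ be integers. A $k$-hypertournament on a vertex set $V$ with $|V|=n$ is a pair $(V,A)$, where $A$ is a set of $k$-tuples of distinct vertices (called arcs) such that for every $k$-subset $S$ of $V$, $A$ contains exactly one of the $k!$ tuples whose entries are the elements of $S$. For an arc $x_1x_2\ldots x_k$, $x_i$ precedes $x_j$ if $i<j$. Let $V=U\uplus W$ be a partition of $V$ into two non-empty subsets (partite sets). A bipartite $k$-hypertournament $B$ with partite sets $U$ and $W$ is obtained from a $k$-hypertournament on $V$ by deleting all arcs whose vertices are all contained in $U$ or all contained in $W$. For vertices $u,w$ in different partite sets, $A_B(u,w)$ is the set of arcs of $B$ that contain both $u$ and $w$ and in which $u$ precedes $w$. If $u,w$ are in the same partite set, $A_B(u,w)=\emptyset$. A path in $B$ of length $q-1$ from $x_1$ to $x_q$ (an $(x_1,x_q)$-path) is an alternating sequence $x_1a_1x_2a_2\dots x_{q-1}a_{q-1}x_q$ of distinct vertices $x_i$ and distinct arcs $a_j$ such that $a_j\in A_B(x_j,x_{j+1})$ for every $j\in\{1,\dots,q-1\}$. (The single vertex $x$ is an $(x,x)$-path of length $0$.) A vertex $x$ is a 4-king of $B$ if for every vertex $y$ there is an $(x,y)$-path of length at most $4$ in $B$. A vertex $v$ is a transmitter of $B$ if $A_B(u,v)=\emptyset$ for every vertex $u$ in a different partite set from $v$. *)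

(* Defs.v *)
From mathcomp Require Import all_boot.

Set Implicit Arguments.
Unset Strict Implicit.
Unset Printing Implicit Defensive.

Record hypertournament (k : nat) (V : finType) := Hypertournament {
  ht_arcs : {set k.-tuple V};
  ht_k_ge2 : 2 <= k;
  ht_k_lt_n : k < #|V|;
  ht_distinct : forall a : k.-tuple V, a \in ht_arcs -> uniq a;
  ht_exactly_one : forall S : {set V}, #|S| = k ->
    #|[set a in ht_arcs | [set x in a] == S]| = 1 }.

Record bipartite_hypertournament (k : nat) (V : finType) :=
  BipartiteHypertournament {
  partU : {set V};
  partW : {set V};
  arcs : {set k.-tuple V};
  partU_neq0 : partU != set0;
  partW_neq0 : partW != set0;
  partUW_disjoint : [disjoint partU & partW];
  partUW_cover : partU :|: partW = [set: V];
  arcs_deletion : exists H : hypertournament k V,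
    arcs = [set a in ht_arcs H |
             ~~ ([set x in a] \subset partU) && ~~ ([set x in a] \subset partW)] }.

Section Bipartite.

Variables (k : nat) (V : finType) (B : bipartite_hypertournament k V).
Implicit Types (u v w x y : V) (a : k.-tuple V).

Definition precedes a u w : bool :=
  [&& u \in a, w \in a & index u a < index w a].

Definition different_parts u w : bool :=
  (u \in partU B) && (w \in partW B) || (u \in partW B) && (w \in partU B).

Definition arcs_between u w : {set k.-tuple V} :=
  if different_parts u w then [set a in arcs B | precedes a u w] else set0.

(* The alternating sequence x_1 a_1 x_2 ... a_(q-1) x_q is encoded by its first
   vertex x_1 together with s = [:: (a_1, x_2); ...; (a_(q-1), x_q)], so that
   its length q - 1 is [size s]. *)
Fixpoint alternating x (s : seq (k.-tuple V * V)) : bool :=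
  if s is (a, y) :: s' then (a \in arcs_between x y) && alternating y s'
  else true.

Definition is_path x y (s : seq (k.-tuple V * V)) : bool :=
  [&& alternating x s, uniq (x :: unzip2 s), uniq (unzip1 s)
    & last x (unzip2 s) == y].

Definition four_king x : Prop :=
  forall y, exists2 s, is_path x y s & size s <= 4.

Definition transmitter v : Prop :=
  forall u, different_parts u v -> arcs_between u v = set0.

End Bipartite.

(* Main.v *)
(* Take n = k + 1 and U = {u}. A vertex of W that never precedes u in an arc
   has no outgoing path of positive length, hence is not a 4-king. Order every
   arc so that u is preceded by at most one fixed vertex w, namely exactly in
   the arcs that contain w and a third vertex z. Then w is the only possible
   4-king in W. The arc avoiding z shows that w is not a transmitter, and an
   arc through u, w and z, which exists as k >= 3, that u is not one. *)
Require Import Defs.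
From mathcomp Require Import all_boot.

Set Implicit Arguments.
Unset Strict Implicit.
Unset Printing Implicit Defensive.

Section OrderedHypertournament.

Variables (k : nat) (V : finType) (L : {set V} -> seq V).
Hypothesis uniqL : forall S, uniq (L S).
Hypothesis memL : forall S x, x \in L S.

(** [L S] ranges over all of [V], so an order may name vertices outside [S]; the filter discards
    them. *)
Definition ordered_seq (S : {set V}) : seq V := [seq x <- L S | x \in S].

(** Arcs are the tuples fixed by sorting their own set of entries, which leaves one candidate for
    each [k]-subset. *)
Definition ordered_arcs : {set k.-tuple V} :=
  [set a : k.-tuple V | tval a == ordered_seq [set x in a]].

Lemma mem_ordered_seq S x : (x \in ordered_seq S) = (x \in S).
Proof. by rewrite mem_filter memL andbT. Qed.

Lemma ordered_seq_uniq S : uniq (ordered_seq S).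
Proof. exact: filter_uniq. Qed.

Lemma size_ordered_seq S : size (ordered_seq S) = #|S|.
Proof.
rewrite -(card_uniqP (ordered_seq_uniq S)).
by apply: eq_card => x; rewrite mem_ordered_seq.
Qed.

Lemma set_ordered_seq S : [set x in ordered_seq S] = S.
Proof. by apply/setP => x; rewrite inE mem_ordered_seq. Qed.

Lemma ordered_arc_exists (S : {set V}) : #|S| = k ->
  exists2 a : k.-tuple V, a \in ordered_arcs & tval a = ordered_seq S.
Proof.
move=> cardS; have sz : size (ordered_seq S) == k by rewrite size_ordered_seq cardS.
by exists (Tuple sz) => //; rewrite in_set /= set_ordered_seq.
Qed.

Lemma ordered_arcs_uniq a : a \in ordered_arcs -> uniq a.
Proof. by rewrite inE => /eqP ->; exact: ordered_seq_uniq. Qed.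

Lemma ordered_arcs_exactly_one (S : {set V}) : #|S| = k ->
  #|[set a in ordered_arcs | [set x in a] == S]| = 1.
Proof.
move=> /ordered_arc_exists[a aA aE]; apply/eqP/cards1P; exists a.
apply/setP => b; rewrite in_set in_set1.
apply/andP/eqP => [[+ /eqP bS]|->].
  by rewrite inE bS -aE => /eqP /val_inj.
by split=> //; apply/eqP/setP => x; rewrite inE memtE aE mem_ordered_seq.
Qed.

Definition ordered_hypertournament (k_ge2 : 2 <= k) (k_lt_n : k < #|V|) :
    hypertournament k V :=
  Hypertournament k_ge2 k_lt_n ordered_arcs_uniq ordered_arcs_exactly_one.

End OrderedHypertournament.

Section Star.

Variables (k : nat) (V : finType) (u : V) (H : hypertournament k V).
Hypothesis V_gt1 : 1 < #|V|.

Definition star_arcs : {set k.-tuple V} :=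
  [set a in ht_arcs H |
    ~~ ([set x in a] \subset [set u]) && ~~ ([set x in a] \subset [set~ u])].

Lemma star_neq0 : [set u] != set0.
Proof. by apply/set0Pn; exists u; rewrite inE. Qed.

Lemma star_neqT : [set~ u] != set0.
Proof. by rewrite -card_gt0 cardsC1 -subn1 subn_gt0. Qed.

Lemma star_disjoint : [disjoint [set u] & [set~ u]].
Proof. by rewrite -setI_eq0 setICr. Qed.

Lemma star_deletion : exists H' : hypertournament k V, star_arcs =
  [set a in ht_arcs H' |
    ~~ ([set x in a] \subset [set u]) && ~~ ([set x in a] \subset [set~ u])].
Proof. by exists H. Qed.

Definition star : bipartite_hypertournament k V :=
  BipartiteHypertournament star_neq0 star_neqT star_disjoint (setUCr _)
    star_deletion.

Lemma different_parts_star x y :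
  different_parts star x y = ((x == u) != (y == u)).
Proof. by rewrite /different_parts !inE; case: eqP; case: eqP. Qed.

(** One of [x], [y] is [u] and the other is not, so an arc through both lies inside neither part and
    survives the deletion. *)
Lemma star_arcs_between (a : k.-tuple V) x y : a \in ht_arcs H ->
  (x == u) != (y == u) -> precedes a x y -> a \in arcs_between star x y.
Proof.
move=> aH xy pxy; rewrite /arcs_between different_parts_star xy !inE aH pxy andbT /=.
have /and3P[xa ya _] := pxy.
apply/andP; split; apply/subsetPn.
  by case: (eqVneq x u) xy => [_ yu|xu _]; [exists y | exists x]; rewrite !inE.
case: (eqVneq x u) xy => [xu _|_ /negbNE yu]; [exists x | exists y].
all: by rewrite !inE ?xu // ?negbK // -?xu.
Qed.

(** A path from [x] to [u] has a first arc, and its first step must enter the other part, which is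
    [u] alone. *)
Lemma star_four_king_precedes x : x != u -> four_king star x ->
  exists2 a : k.-tuple V, a \in ht_arcs H & precedes a x u.
Proof.
move=> xu /(_ u)[[|[a y] s]]; first by rewrite /is_path /= (negPf xu).
rewrite /is_path /= => /and4P[/andP[+ _] _ _ _] _; rewrite /arcs_between different_parts_star.
rewrite (negPf xu); case: (eqVneq y u) => [->|_] /=; last by rewrite inE.
by case/setIdP => /setIdP[aH _] pa; exists a.
Qed.

End Star.

Section KingOrder.

Variables (V : finType) (u w z : V).
Hypothesis wu : w != u.

(** Testing [z] is enough: if [w] is not in [S], filtering leaves [u] in front in both cases. *)
Definition king_order (S : {set V}) : seq V :=
  (if z \in S then [:: w; u] else [:: u; w])
    ++ [seq x <- enum V | x \notin [:: u; w]].

Lemma king_order_uniq (S : {set V}) : uniq (king_order S).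
Proof.
rewrite cat_uniq filter_uniq ?enum_uniq // andbT.
apply/andP; split; first by case: ifP; rewrite /= inE ?wu // eq_sym wu.
apply/hasPn => x; rewrite mem_filter => /andP[+ _].
by case: ifP => _; rewrite !inE // orbC.
Qed.

Lemma mem_king_order S x : x \in king_order S.
Proof.
rewrite mem_cat mem_filter mem_enum andbT.
by case: ifP => _; rewrite !inE // orbC; case: (x == u); case: (x == w).
Qed.

(** After filtering, [u] comes first unless both [w] and [z] lie in [S]; then [w] alone stands
    before it. *)
Lemma index_king_order (S : {set V}) x :
  u \in S -> x != u -> (x != w) || (z \notin S) ->
  index u (ordered_seq king_order S) < index x (ordered_seq king_order S).
Proof.
rewrite ![x == _]eq_sym => uS /negPf ux; rewrite /ordered_seq /king_order.
case: (z \in S); rewrite /= uS ?orbF => wx; case: (w \in S).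
all: by rewrite /= eqxx ?(negPf wu) ?ux // (negPf wx).
Qed.

Lemma index_king_order_w (S : {set V}) : u \in S -> w \in S -> z \in S ->
  index w (ordered_seq king_order S) < index u (ordered_seq king_order S).
Proof.
by move=> uS wS zS; rewrite /ordered_seq /king_order zS /= uS wS /= eqxx (negPf wu).
Qed.

End KingOrder.

Theorem proposition12 (k : nat) (hk : 3 <= k) :
  exists (V : finType) (B : bipartite_hypertournament k V),
    (forall v : V, ~ transmitter B v) /\
    (forall x y : V, x \in partU B -> y \in partU B ->
       four_king B x -> four_king B y -> x = y) /\
    (forall x y : V, x \in partW B -> y \in partW B ->
       four_king B x -> four_king B y -> x = y).
Proof.
case: k hk => [|[|[|m]]] // _.
(* With [k = m + 3] there are [k + 1 >= 4] vertices, enough for a fourth vertex [t] besides [u], [w]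
   and [z]. *)
pose u : 'I_m.+4 := @Ordinal m.+4 0 isT; pose w : 'I_m.+4 := @Ordinal m.+4 1 isT.
pose z : 'I_m.+4 := @Ordinal m.+4 2 isT; pose t : 'I_m.+4 := @Ordinal m.+4 3 isT.
have wu : w != u by [].
have card_lt : m.+3 < #|'I_m.+4| by rewrite card_ord.
pose H := ordered_hypertournament (king_order_uniq z wu)
            (mem_king_order u w z) (isT : 2 <= m.+3) card_lt.
have V_gt1 : 1 < #|'I_m.+4| by rewrite card_ord.
pose B := star u H V_gt1.
(* Since [n = k + 1], each arc is determined by the one vertex [y] that it omits. *)
have arc y : exists2 a : m.+3.-tuple 'I_m.+4, a \in ht_arcs H &
    tval a = ordered_seq (king_order u w z) [set~ y].
  apply: ordered_arc_exists; [exact: king_order_uniq|exact: mem_king_order|].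
  by rewrite cardsC1 card_ord.
have memE := mem_ordered_seq (mem_king_order u w z).
have king_eq_w x : x \in partW B -> four_king B x -> x = w.
  rewrite !inE => xu /(star_four_king_precedes xu)[a].
  rewrite inE => /eqP aE /and3P[_ ua lt_xu].
  apply/eqP/negPn/negP => xw.
  have := @index_king_order _ u w z wu [set y in a] x.
  by rewrite inE ua xu xw -aE => /(_ isT isT isT); rewrite ltnNge ltnW.
exists 'I_m.+4, B; split; [move=> v tv | split].
(* A single arc in which a vertex of the other part precedes [v] refutes [tv]. *)
- have nottv x a : a \in ht_arcs H -> (x == u) != (v == u) -> ~ precedes a x v.
    move=> aH xv /(star_arcs_between V_gt1 aH xv).
    by rewrite tv ?inE // different_parts_star.
  have [vu|vu] := eqVneq v u.
    (* Omitting [t] keeps [u], [w] and [z], so [w] precedes [u]. *)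
    have [a aH aE] := arc t; apply: (nottv w a aH); first by rewrite vu.
    by rewrite /precedes vu !memtE aE !memE index_king_order_w // !inE.
  (* Now [v] is in [W], and the arc should contain [u] and [v] with [u] first: omit [z] if [v = w],
     and omit [w] otherwise. *)
  have [y [yu yv vy]] : exists y, [/\ u != y, v != y & (v != w) || (z == y)].
    by have [->|vw] := eqVneq v w; [exists z | exists w; rewrite vw].
  have [a aH aE] := arc y; apply: (nottv u a aH); first by rewrite eqxx (negPf vu).
  by rewrite /precedes !memtE aE !memE index_king_order ?inE ?negbK ?yu ?yv.
- by move=> x y; rewrite !inE => /eqP-> /eqP->.
- by move=> x y xW yW /(king_eq_w _ xW)-> /(king_eq_w _ yW)->.
Qed.
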